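(* Let $P$ be a prior distribution on the full parameter space of a $T$-layer model $h_{W_{1:T}}$, with parameters denoted $W_{1:T}$. Let $W_T\in\mathbb R^{m_T}$ be the weights of the last linear layer, and assume that the marginal distribution of $W_T$ under $P$ is $\mathcal N(0,\sigma^2I_{m_T})$ with $\sigma>0$. Assume that there exists $M>0$ such that, for all $x\in X$, $\|h_{W_{1:T}}(x)\|\le M\|W_T\|$. Let $\ell>0$, $n\ge1$, and choose $$\lambda=\frac{\sqrt n}{M\ell\sigma\sqrt{m_T+1}}.$$ Then, with $a_{W_{1:T}}:=M\|W_T\|$, $$\frac1\lambda\ln\mathbb E_{W_{1:T}\sim P}\exp\left(\frac{\lambda^2\ell^2a_{W_{1:T}}^2}{2n}\right)\le\frac{M\ell\sigma\sqrt{m_T+1}}{2\sqrt n}.$$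
   Context: $W_{1:T}=(W_1,\dots,W_T)$ denotes the collection of the weights of all layers of the model; $\|W_T\|$ is the Euclidean norm of $W_T$ viewed as a vector in $\mathbb R^{m_T}$. *)

(* Defs.v *)
From HB Require Import structures.
From mathcomp Require Import all_boot all_order all_algebra.
From mathcomp Require Import all_classical all_reals all_analysis.

Set Implicit Arguments.
Unset Strict Implicit.
Unset Printing Implicit Defensive.

Import Order.TTheory GRing.Theory Num.Theory.
Import numFieldNormedType.Exports.

Local Open Scope classical_set_scope.
Local Open Scope ring_scope.

(* Vectors of R^m are m-tuples, because these carry the product
   (Borel) sigma-algebra in the library; the norm that the library puts on
   matrices and row vectors is the sup norm. *)
Definition euclid_norm (R : realType) (m : nat) (w : m.-tuple R) : R :=
  Num.sqrt (\sum_(i < m) tnth w i ^+ 2).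

(* The parameters W_1, ..., W_T of a model with T = L.+1 layers, W_t in
   R^(m t): layers are numbered from 0 and the last one is ord_max. *)
Definition weights (R : realType) (L : nat) (m : 'I_L.+1 -> nat) : Type :=
  forall t : 'I_L.+1, (m t).-tuple R.

HB.instance Definition _ (R : realType) (L : nat) (m : 'I_L.+1 -> nat) :=
  Pointed.copy (weights R m) (forall t : 'I_L.+1, (m t).-tuple R).

(* The product sigma-algebra, generated by the coordinate projections. *)
Definition layer_cylinders (R : realType) (L : nat) (m : 'I_L.+1 -> nat) :
    set (set (weights R m)) :=
  \bigcup_(t in [set: 'I_L.+1])
    preimage_set_system [set: weights R m] (fun W => W t) measurable.

Notation param_space R m := (g_sigma_algebraType (@layer_cylinders R _ m)).

Definition layer (R : realType) (L : nat) (m : 'I_L.+1 -> nat)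
  (t : 'I_L.+1) (W : param_space R m) : (m t).-tuple R := W t.

Lemma measurable_layer (R : realType) (L : nat) (m : 'I_L.+1 -> nat)
    (t : 'I_L.+1) :
  measurable_fun [set: param_space R m] (@layer R L m t).
Proof.
move=> _ A mA; apply: sub_sigma_algebra.
by exists t => //; exists A.
Qed.

HB.instance Definition _ (R : realType) (L : nat) (m : 'I_L.+1 -> nat)
    (t : 'I_L.+1) :=
  isMeasurableFun.Build _ _ _ _ (@layer R L m t)
    (@measurable_layer R L m t).

(* The one-dimensional normal distribution of the library lives on
   [measurableTypeR R], which differs from R only by its display. *)
Definition tuple_cons (R : realType) (m : nat)
  (p : measurableTypeR R * m.-tuple R) : m.+1.-tuple R := [tuple of p.1 :: p.2].

Lemma measurable_tuple_cons (R : realType) (m : nat) :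
  measurable_fun [set: measurableTypeR R * m.-tuple R] (@tuple_cons R m).
Proof.
apply: (@measurable_cons _ _ _ R).
- exact: (@measurable_fst _ _ (measurableTypeR R) (m.-tuple R)).
- exact: (@measurable_snd _ _ (measurableTypeR R) (m.-tuple R)).
Qed.

HB.instance Definition _ (R : realType) (m : nat) :=
  isMeasurableFun.Build _ _ _ _ (@tuple_cons R m)
    (@measurable_tuple_cons R m).

(* N(0, s^2 I_m), as the product of m copies of the one-dimensional normal
   distribution N(0, s^2); [normal_prob] takes the standard deviation s, not
   the variance. *)
Fixpoint iso_normal_prob (R : realType) (s : R) (m : nat) :
    probability (m.-tuple R) R :=
  match m with
  | 0 => \d_([tuple] : 0.-tuple R)
  | k.+1 => distribution (normal_prob 0 s \x iso_normal_prob s k)%E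
              (@tuple_cons R k)
  end.

(* Main.v *)
(* With the given lambda, the exponent is |W_T|^2 / (2 sigma^2 (m_T + 1)).
   Multiplying the N(0, s^2) density by exp((s^-2 - t^-2) x^2 / 2) gives t / s
   times the N(0, t^2) density, so by Tonelli the expectation is (t / s)^m_T,
   where s = sigma and t^2 = sigma^2 (1 + 1 / m_T). Finally
   (1 + 1 / m_T)^(m_T / 2) <= exp(1 / 2). *)
Require Import Defs.
From mathcomp Require Import all_boot all_order all_algebra.
From mathcomp Require Import all_classical all_reals all_analysis.
From mathcomp Require Import measurable_realfun ring lra.

Import Order.TTheory GRing.Theory Num.Theory.
Import numFieldNormedType.Exports.

Local Open Scope classical_set_scope.
Local Open Scope ring_scope.

(** The Radon-Nikodym derivative of [normal_prob] turns its integral into a Lebesgue integral; being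
    unique almost everywhere, it can be traded for [normal_pdf]. *)
Lemma ge0_integral_normal_prob (R : realType) (mean s : R)
    (f : measurableTypeR R -> \bar R) :
  measurable_fun [set: measurableTypeR R] f -> (forall x, 0 <= f x)%E ->
  (\int[normal_prob mean s]_x f x =
   \int[lebesgue_measure]_x (f x * (normal_pdf mean s x)%:E))%E.
Proof.
move=> mf f0.
have mpdf : measurable_fun [set: measurableTypeR R]
    (fun x => (normal_pdf mean s x)%:E).
  by apply/measurable_EFinP; exact: measurable_normal_pdf.
have dom := normal_prob_dominates mean s.
have intRN := Radon_Nikodym_SigmaFinite.f_integrable dom.
rewrite -(Radon_Nikodym_SigmaFinite.change_of_variables dom)//.
apply: ae_eq_integral => //.
- by apply: emeasurable_funM => //; exact: measurable_int intRN.
- exact: emeasurable_funM.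
(* Both densities integrate to [normal_prob mean s E] over every measurable [E], hence agree almost
   everywhere. *)
apply: ae_eqe_mul2l; apply: integral_ae_eq => // E _ mE.
by rewrite -Radon_Nikodym_SigmaFinite.f_integral.
Qed.

Lemma integral_normal_prob_expR_sqr (R : realType) (s t : R) :
  0 < s -> 0 < t ->
  (\int[normal_prob 0 s]_x (expR ((s ^- 2 - t ^- 2) / 2 * x ^+ 2))%:E =
   (t / s)%:E)%E.
Proof.
move=> s0 t0; rewrite ge0_integral_normal_prob; first last.
- by move=> x; rewrite lee_fin expR_ge0.
- apply/measurable_EFinP/measurableT_comp => //=.
  exact/measurable_funM/measurable_funX.
have sN0 := lt0r_neq0 s0; have tN0 := lt0r_neq0 t0.
(* With [u] outside the square root, the peak for [s] is visibly [t / s] times the peak for [t]. *)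
have peak u : 0 < u -> normal_peak u = u^-1 * (Num.sqrt (pi *+ 2) : R)^-1.
  move=> u0; rewrite /normal_peak -mulrnAr sqrtrM ?sqr_ge0//.
  by rewrite sqrtr_sqr gtr0_norm// invfM.
transitivity
    (\int[@lebesgue_measure R]_x ((t / s)%:E * (normal_pdf 0 t x)%:E))%E.
  apply: eq_integral => x _; rewrite -!EFinM; congr EFin.
  rewrite !normal_pdfE// !peak// /normal_fun !subr0.
  rewrite mulrCA -expRD [in RHS]mulrA [in RHS]mulrA.
  congr (_ * expR _); last by field; rewrite sN0 tN0.
  by congr (_ * _); field; rewrite sN0 tN0.
rewrite ge0_integralZl//.
- by rewrite integral_normal_pdf mule1.
- by apply/measurable_EFinP; exact: measurable_normal_pdf.
- by move=> x _; rewrite lee_fin normal_pdf_ge0.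
- by rewrite lee_fin divr_ge0 ?ltW.
Qed.

Lemma measurable_euclid_norm_sqr (R : realType) (m : nat) :
  measurable_fun [set: m.-tuple R] (fun w => euclid_norm w ^+ 2).
Proof.
rewrite (_ : (fun _ => _) = fun w : m.-tuple R => \sum_(i < m) tnth w i ^+ 2).
  apply: measurable_sum => i; apply: measurable_funX; exact: measurable_tnth.
by apply/funext => w; rewrite sqr_sqrtr ?sumr_ge0// => i _; exact: sqr_ge0.
Qed.

Lemma euclid_norm_cons_sqr (R : realType) (m : nat)
    (p : measurableTypeR R * m.-tuple R) :
  euclid_norm (@tuple_cons R m p) ^+ 2 = p.1 ^+ 2 + euclid_norm p.2 ^+ 2.
Proof.
rewrite !sqr_sqrtr ?sumr_ge0//; try by move=> i _; exact: sqr_ge0.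
rewrite big_ord_recl tnth0; congr (_ + _).
by apply: eq_bigr => i _; rewrite tnthS.
Qed.

(** Induction on [m]: the squared norm is additive over head and tail, so the exponential factorizes
    and each coordinate contributes one factor [t / s]. *)
Lemma integral_iso_normal_prob_expR_sqr (R : realType) (s t : R) (m : nat) :
  0 < s -> 0 < t ->
  (\int[iso_normal_prob s m]_w
     (expR ((s ^- 2 - t ^- 2) / 2 * euclid_norm w ^+ 2))%:E =
   ((t / s) ^+ m)%:E)%E.
Proof.
move=> s0 t0; set c := (_ - _) / 2.
have mexp k : measurable_fun [set: k.-tuple R]
    (fun w => (expR (c * euclid_norm w ^+ 2))%:E).
  apply/measurable_EFinP/measurableT_comp => //.
  apply: measurable_funM => //; exact: measurable_euclid_norm_sqr.
have exp0 k (w : k.-tuple R) : (0 <= (expR (c * euclid_norm w ^+ 2))%:E)%E.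
  by rewrite lee_fin expR_ge0.
elim: m => [|m IH].
  rewrite [LHS]integral_dirac//; last exact: mexp.
  rewrite diracE in_setT mul1e.
  by rewrite sqr_sqrtr big_ord0// mulr0 expR0.
rewrite [LHS]ge0_integral_distribution//; last exact: mexp.
rewrite (fubini_tonelli1 _
  (measurableT_comp (mexp m.+1) (@measurable_tuple_cons R m)))//;
  last by move=> p; exact: exp0.
rewrite -/(iso_normal_prob s m).
rewrite /fubini_F /=.
under eq_integral => x _.
  (* For a fixed head [x], its factor is a constant that leaves the inner integral; the tail is then
     the induction hypothesis. *)
  under eq_integral do rewrite euclid_norm_cons_sqr/= mulrDr expRD EFinM.
  rewrite ge0_integralZl ?lee_fin ?expR_ge0//; last exact: mexp.
  rewrite IH.
  over.
rewrite ge0_integralZr//; first last.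
- by rewrite lee_fin exprn_ge0// divr_ge0// ltW.
- apply/measurable_EFinP/measurableT_comp => //=.
  exact/measurable_funM/measurable_funX.
by rewrite integral_normal_prob_expR_sqr// -EFinM exprS.
Qed.

(** The inequality 1 + y <= exp(y) at y = 1 / m, after taking square roots and raising to the power
    m. *)
Lemma sqrt_1Dinv_exp_le (R : realType) (m : nat) :
  Num.sqrt (1 + m%:R^-1) ^+ m <= expR (1 / 2) :> R.
Proof.
(* The case m = 0 is separate: the left side is an empty power, and m / m = 1 fails. *)
have [->|m0] := posnP m; first by rewrite expr0 -[leLHS]expR0 ler_expR; lra.
have m0' : m%:R != 0 :> R by rewrite pnatr_eq0 -lt0n.
have -> : 1 / 2 = m%:R^-1 / 2 * m%:R :> R by field.
rewrite expRM_natr lerXn2r ?nnegrE ?sqrtr_ge0 ?expR_ge0//.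
(* Writes exp(1 / (2 m)) as the square root of exp(1 / m). *)
rewrite -[leRHS]ger0_norm ?expR_ge0// -sqrtr_sqr -expRM_natr divfK//.
by rewrite ler_wsqrtr// expR_ge1Dx.
Qed.

Theorem lemma3p8 (R : realType) (L : nat) (m : 'I_L.+1 -> nat)
    (X : Type) (V : normedModType R) (h : param_space R m -> X -> V)
    (P : probability (param_space R m) R) (sigma M l lambda : R) (n : nat) :
  let m_T := m ord_max in
  let W_T : {mfun param_space R m >-> m_T.-tuple R} := @layer R L m ord_max in
  let a := fun W : param_space R m => M * euclid_norm (W_T W) in
  0 < sigma ->
  (forall A : set (m_T.-tuple R), measurable A ->
     distribution P W_T A = iso_normal_prob sigma m_T A) ->
  0 < M ->
  (forall (W : param_space R m) (x : X), `|h W x| <= M * euclid_norm (W_T W)) ->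
  0 < l ->
  (1 <= n)%N ->
  lambda = Num.sqrt n%:R / (M * l * sigma * Num.sqrt (m_T%:R + 1)) ->
  ((lambda^-1)%:E *
     lne ('E_P [fun W => expR (lambda ^+ 2 * l ^+ 2 * a W ^+ 2 / (2 * n%:R))])
   <= (M * l * sigma * Num.sqrt (m_T%:R + 1) / (2 * Num.sqrt n%:R))%:E)%E.
Proof.
move=> m_T W_T a s0 W_T_law M0 _ l0 n0 lambdaE.
have q0 : 0 < Num.sqrt n%:R :> R by rewrite sqrtr_gt0 ltr0n.
have r0 : 0 < Num.sqrt (m_T%:R + 1) :> R by rewrite sqrtr_gt0 ltr_wpDl.
have qE : Num.sqrt n%:R ^+ 2 = n%:R :> R by rewrite sqr_sqrtr.
have rE : Num.sqrt (m_T%:R + 1) ^+ 2 = m_T%:R + 1 :> R.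
  by rewrite sqr_sqrtr// addr_ge0.
have u0 : 0 < Num.sqrt (1 + m_T%:R^-1) :> R.
  by rewrite sqrtr_gt0 ltr_wpDr ?invr_ge0.
have uE : Num.sqrt (1 + m_T%:R^-1) ^+ 2 = 1 + m_T%:R^-1 :> R.
  by rewrite sqr_sqrtr// addr_ge0// invr_ge0.
(* If m_T = 0, then 1 / m_T is 0 and t = sigma, which is harmless because the
   norm vanishes. *)
pose t := sigma * Num.sqrt (1 + m_T%:R^-1).
have t0 : 0 < t by rewrite mulr_gt0.
have exponentE (w : m_T.-tuple R) :
    lambda ^+ 2 * l ^+ 2 * (M * euclid_norm w) ^+ 2 / (2 * n%:R) =
    (sigma ^- 2 - t ^- 2) / 2 * euclid_norm w ^+ 2.
  have [m0|m0] := posnP m_T.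
    have -> : euclid_norm w = 0.
      rewrite /euclid_norm big1 ?sqrtr0// => i.
      by move: (ltn_ord i); rewrite {2}m0.
    by rewrite expr0n/= !(mulr0, mul0r) expr0n/= !(mulr0, mul0r).
  have m0' : 0 < m_T%:R :> R by rewrite ltr0n.
  (* Both coefficients are 1 / (2 sigma^2 (m_T + 1)), because 1 - sigma^2 / t^2 = 1 - m_T / (m_T +
     1). *)
  rewrite lambdaE /t !exprMn exprVn !exprMn uE qE rE.
  field.
  by rewrite !lt0r_neq0 ?ltr0n ?addr_gt0.
have EE : ('E_P [fun W => expR (lambda ^+ 2 * l ^+ 2 * a W ^+ 2 / (2 * n%:R))]
    = (Num.sqrt (1 + m_T%:R^-1) ^+ m_T)%:E)%E.
  have -> : Num.sqrt (1 + m_T%:R^-1) = t / sigma :> R.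
    by rewrite /t mulrAC divff ?mul1r// lt0r_neq0.
  rewrite -integral_iso_normal_prob_expR_sqr//.
  (* Measures that agree on measurable sets have equal integrals: the Gaussian is replaced by the
     law of [W_T], whose integral is then pulled back to [P]. *)
  rewrite -(eq_measure_integral _ (fun A mA _ => W_T_law A mA)).
  rewrite ge0_integral_distribution; first last.
  - by move=> w; rewrite lee_fin expR_ge0.
  - apply/measurable_EFinP/measurableT_comp => //.
    apply: measurable_funM => //; exact: measurable_euclid_norm_sqr.
  rewrite unlock; apply: eq_integral => W _.
  by rewrite exponentE.
rewrite EE lne_EFin ?exprn_gt0// -EFinM lee_fin.
(* The bound is half of 1 / lambda, so it remains to see that the logarithm is at most 1 / 2. *)
have -> : M * l * sigma * Num.sqrt (m_T%:R + 1) / (2 * Num.sqrt n%:R) =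
    lambda^-1 * (1 / 2).
  rewrite lambdaE; field.
  by rewrite !lt0r_neq0.
rewrite ler_wpM2l//.
  by rewrite invr_ge0 lambdaE divr_ge0 ?mulr_ge0 ?ltW.
by rewrite -[leRHS]expRK ler_ln ?posrE ?exprn_gt0 ?expR_gt0// sqrt_1Dinv_exp_le.
Qed.
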